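(* There exists a unique spectral band for which either the upper or the lower edge is equal to $0$ if and only if $\mathsf{c}\in\{c_p,\tilde c_p\}_{p\ge0}$.
   Context: Let $\hbar,m,L_0,V_0>0$. Let $V$ be the $2L_0$-periodic function on $\mathbb{R}$ with $V(x)=V_0(|x|/L_0-1)$ for $x\in[-L_0,L_0]$, and $H=-\frac{\hbar^2}{2m}\frac{d^2}{dx^2}+V$ acting on the Sobolev space $H^2(\mathbb{R})$. Its spectrum is $\sigma(H)=\bigcup_{p\ge 0}[E_{\mathrm{min}}^p,E_{\mathrm{max}}^p]$, where $E_{\mathrm{min}}^0\le E_{\mathrm{max}}^1\le E_{\mathrm{min}}^2\le\dots$ are the eigenvalues of $-\frac{\hbar^2}{2m}\frac{d^2}{dx^2}+V$ on $[-L_0,L_0]$ with periodic boundary conditions, and $E_{\mathrm{max}}^0\le E_{\mathrm{min}}^1\le E_{\mathrm{max}}^2\le\dots$ those with antiperiodic boundary conditions. The $p$-th spectral band is $[E_{\mathrm{min}}^p,E_{\mathrm{max}}^p]$, with lower edge $E_{\mathrm{min}}^p$ and upper edge $E_{\mathrm{max}}^p$. Set $\mathsf{c}=\left(\frac{2mV_0L_0^2}{\hbar^2}\right)^{1/3}$. Let $u,v$ be the solutions of the Airy equation $y''=xy$ with $u(0)=1,u'(0)=0$ and $v(0)=0,v'(0)=1$. Arranged in decreasing order: the zeroes of $v'$ are $-c_{2j}$, $j\ge0$; the nonzero zeroes of $v$ are $-c_{2j+1}$, $j\ge0$; the zeroes of $u$ are $-\tilde c_{2j}$, $j\ge0$;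 the nonzero zeroes of $u'$ are $-\tilde c_{2j+1}$, $j\ge0$ (all negative). *)

(* Defs.v *)
From Stdlib Require Import Reals Arith List.
From Coquelicot Require Import Coquelicot.
Open Scope R_scope.

(** [V] is the [2 L0]-periodic function on the line equal to
    [V0 (|x| / L0 - 1)] on [[-L0, L0]]. *)
Definition triangular_potential (L0 V0 : R) (V : R -> R) : Prop :=
  (forall x, V (x + 2 * L0) = V x) /\
  (forall x, - L0 <= x <= L0 -> V x = V0 * (Rabs x / L0 - 1)).

(** Derivative relative to [[a, b]]: two-sided at interior points, one-sided
    at [a] and [b].  Values of [f] outside [[a, b]] play no role. *)
Definition is_derive_on (a b : R) (f : R -> C) (x : R) (l : C) : Prop :=
  filterdiff (K := R_AbsRing) (U := R_NormedModule) (V := C_R_NormedModule)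
    f (within (fun y => a <= y <= b) (locally x))
    (fun h => scal (V := C_R_NormedModule) h l).

(** [psi], seen as a function on [[-L0, L0]], belongs to the kernel of
    [- hbar^2 / (2 m) d^2/dx^2 + V - E] with boundary conditions
    [psi (L0) = s psi (-L0)] and [psi' (L0) = s psi' (-L0)]; [s = 1] is the
    periodic problem and [s = -1] the antiperiodic one.  As [V] is continuous,
    [H^2] solutions are classical ones. *)
Definition eigenspace (hbar m L0 : R) (V : R -> R) (s E : R)
    (psi : R -> C) : Prop :=
  exists dpsi d2psi : R -> C,
    (forall x, - L0 <= x <= L0 -> is_derive_on (- L0) L0 psi x (dpsi x)) /\
    (forall x, - L0 <= x <= L0 -> is_derive_on (- L0) L0 dpsi x (d2psi x)) /\
    (forall x, - L0 <= x <= L0 ->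
       (RtoC (- (hbar ^ 2 / (2 * m))) * d2psi x + RtoC (V x) * psi x
        = RtoC E * psi x)%C) /\
    psi L0 = (RtoC s * psi (- L0)%R)%C /\
    dpsi L0 = (RtoC s * dpsi (- L0)%R)%C.

(** Value at [x] of [a 1 * b 1 + ... + a n * b n] (zero for [n = 0]). *)
Definition lin_comb (n : nat) (a : nat -> C) (b : nat -> R -> C) (x : R) : C :=
  sum_n_m (G := C_AbelianMonoid) (fun i => (a i * b i x)%C) 1 n.

(** The complex vector space of (restrictions to [I] of) functions satisfying
    [W] has dimension [n]: it has a basis [b 1, ..., b n].  Functions are
    identified when they agree on [I]. *)
Definition has_dim (I : R -> Prop) (W : (R -> C) -> Prop) (n : nat) : Prop :=
  exists b : nat -> R -> C,
    (forall i, (1 <= i <= n)%nat -> W (b i)) /\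
    (forall a : nat -> C,
       (forall x, I x -> lin_comb n a b x = RtoC 0) ->
       forall i, (1 <= i <= n)%nat -> a i = RtoC 0) /\
    (forall psi, W psi ->
       exists a : nat -> C, forall x, I x -> psi x = lin_comb n a b x).

Definition occurs (e : nat -> R) (E : R) (n : nat) : Prop :=
  exists l : list nat,
    NoDup l /\ length l = n /\ forall p, In p l <-> e p = E.

(** [e 0 <= e 1 <= ...] is the list of all eigenvalues, each repeated according
    to its multiplicity (real numbers that are not eigenvalues are covered by
    [n = 0]). *)
Definition lists_eigenvalues (hbar m L0 : R) (V : R -> R) (s : R)
    (e : nat -> R) : Prop :=
  (forall p, e p <= e (S p)) /\
  (forall E n,
     has_dim (fun x => - L0 <= x <= L0) (eigenspace hbar m L0 V s E) n <->
     occurs e E n).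

(** The [p]-th band is [[Emin p, Emax p]]: the periodic eigenvalues are
    [Emin 0 <= Emax 1 <= Emin 2 <= ...] and the antiperiodic ones are
    [Emax 0 <= Emin 1 <= Emax 2 <= ...]. *)
Definition band_edges (hbar m L0 : R) (V : R -> R) (Emin Emax : nat -> R)
    : Prop :=
  lists_eigenvalues hbar m L0 V 1
    (fun p => if Nat.even p then Emin p else Emax p) /\
  lists_eigenvalues hbar m L0 V (-1)
    (fun p => if Nat.even p then Emax p else Emin p).

Definition airy_solution (y : R -> R) : Prop :=
  (forall x, ex_derive y x) /\
  (forall x, is_derive (Derive y) x (x * y x)).

Definition lists_decreasing (P : R -> Prop) (z : nat -> R) : Prop :=
  (forall j, z (S j) < z j) /\
  (forall x, P x <-> exists j, x = z j).

(* Main.v *)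
Require Import Defs.
From Stdlib Require Import Reals Arith List Lra Lia Classical.
From Coquelicot Require Import Coquelicot.
Open Scope R_scope.

(** At energy [0], with [k = cc / L0], the equation on [[0, L0]] is Airy's equation in [k (x - L0)].
    Since [V] is even, (anti)periodic solutions split into even and odd ones, and [0] is a periodic
    eigenvalue iff [u' v] vanishes at [- cc], an antiperiodic one iff [u v'] does.  The Wronskian
    [u v' - u' v = 1] prevents both from happening.  Uniqueness of the band also needs the
    eigenvalue to be simple, i.e. [u'] and [v] (resp. [u] and [v']) have no common negative zero.
    With [U x = u (- x)] and [W x = - v (- x)] this follows from the positivity for [x > 0] of
    [K = 2 x (x U W + U' W') + U' W]: [K] would be [0], resp. [-1], at a common zero.  Up to a power
    of [x], [K] is the Wronskian of the solutions [x^(1/4) W] and [x^(-1/4) U'] of two Bessel-type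
    equations in the variable [2/3 x^(3/2)]. *)

(** * Extremal zeros of continuous functions, and monotonicity from derivatives *)

Lemma continuous_locally_pos (f : R -> R) (x : R) :
  continuous f x -> 0 < f x -> exists d : posreal, forall y, Rabs (y - x) < d -> 0 < f y.
Proof.
intros Hf Hx.
destruct (Hf _ (open_gt 0 (f x) Hx)) as [d Hd].
exists d; intros y Hy; apply Hd; exact Hy.
Qed.

(** The zero is the supremum of the points up to which [f] stays positive: [f z > 0] would push this
    supremum further, and [f z < 0] would make [f] negative just before it. *)
Lemma first_zero (f : R -> R) (a b : R) :
  (forall x, continuous f x) -> a < b -> 0 < f a -> f b <= 0 ->
  exists z, a < z <= b /\ f z = 0 /\ forall x, a <= x < z -> 0 < f x.
Proof.
intros Hf Hab Ha Hb.
set (E := fun t => a <= t <= b /\ forall x, a <= x <= t -> 0 < f x).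
assert (Ea : E a) by (split; [lra | intros x Hx; replace x with a by lra; exact Ha]).
destruct (completeness E) as [z [Hub Hlub]].
{ exists b; intros t [Ht _]; lra. }
{ exists a; exact Ea. }
assert (Hbz : z <= b) by (apply Hlub; intros t [Ht _]; lra).
assert (Haz : a <= z) by (apply Hub; exact Ea).
assert (Hpos : forall x, a <= x < z -> 0 < f x).
{ intros x Hx.
  destruct (classic (exists t, E t /\ x < t)) as [[t [[_ Ht] Hxt]] | Hn].
  - apply Ht; lra.
  - exfalso. assert (z <= x); [apply Hlub; intros t Ht | lra].
    destruct (Rle_dec t x); [assumption | exfalso; apply Hn; exists t; split; [exact Ht | lra]]. }
assert (Hz0 : f z <= 0).
{ destruct (Rle_lt_dec (f z) 0) as [H | H]; [exact H | exfalso].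
  destruct (continuous_locally_pos f z (Hf z) H) as [d Hd].
  destruct (Rle_lt_dec b z) as [Hzb | Hzb].
  { replace z with b in H by lra; lra. }
  pose proof (cond_pos d) as Hdp.
  assert (Ht : E (Rmin b (z + d / 2))).
  { pose proof (Rmin_l b (z + d / 2)); pose proof (Rmin_r b (z + d / 2)).
    split.
    - split; [apply Rmin_glb; lra | lra].
    - intros x Hx. destruct (Rlt_le_dec x z) as [Hxz | Hxz]; [apply Hpos; lra |].
      apply Hd; rewrite Rabs_pos_eq; lra. }
  apply Hub in Ht.
  assert (z < Rmin b (z + d / 2)) by (apply Rmin_glb_lt; lra); lra. }
assert (Hz1 : 0 <= f z).
{ destruct (Rle_lt_dec 0 (f z)) as [H | H]; [exact H | exfalso].
  destruct (continuous_locally_pos (fun x => - f x) z) as [d Hd].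
  { apply (continuous_opp (V := R_NormedModule) f z (Hf z)). }
  { lra. }
  destruct (Req_dec a z) as [<- | Haz']; [lra |].
  pose proof (cond_pos d) as Hdp.
  pose proof (Rmax_l a (z - d / 2)); pose proof (Rmax_r a (z - d / 2)).
  assert (Rmax a (z - d / 2) < z) by (apply Rmax_lub_lt; lra).
  assert (0 < f (Rmax a (z - d / 2))) by (apply Hpos; lra).
  assert (0 < - f (Rmax a (z - d / 2))); [| lra].
  apply Hd; rewrite Rabs_left; lra. }
exists z; split; [| split; [lra | exact Hpos]].
split; [| exact Hbz].
destruct (Req_dec a z) as [<- | ]; lra.
Qed.

Lemma last_zero (f : R -> R) (a b : R) :
  (forall x, continuous f x) -> a < b -> f a <= 0 -> 0 < f b ->
  exists z, a <= z < b /\ f z = 0 /\ forall x, z < x <= b -> 0 < f x.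
Proof.
intros Hf Hab Ha Hb.
destruct (first_zero (fun x => f (- x)) (- b) (- a)) as [z [Hz [Hfz Hpos]]].
- intros x. apply continuous_comp; [| apply Hf].
  apply (continuous_opp (V := R_NormedModule) (fun y => y)), continuous_id.
- lra.
- now rewrite Ropp_involutive.
- now rewrite Ropp_involutive.
- exists (- z); repeat split; try lra.
  intros x Hx; rewrite <- (Ropp_involutive x); apply Hpos; lra.
Qed.

Lemma derive_pos_increasing (f f' : R -> R) (a b : R) :
  (forall x, is_derive f x (f' x)) -> a < b -> (forall x, a < x < b -> 0 < f' x) ->
  f a < f b.
Proof.
intros Hf Hab Hpos.
destruct (MVT_cor2 f f' a b Hab) as [x [Hx Hx']].
{ intros; apply is_derive_Reals, Hf. }
assert (0 < f' x * (b - a)) by (apply Rmult_lt_0_compat; [apply Hpos |]; lra).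
lra.
Qed.

Lemma derive_zero_constant (f : R -> R) (a b : R) :
  a <= b -> (forall x, a <= x <= b -> is_derive f x 0) -> f a = f b.
Proof.
intros [Hab | <-] Hf; [| reflexivity].
destruct (MVT_cor2 f (fun _ => 0) a b Hab) as [x [Hx _]].
{ intros; apply is_derive_Reals, Hf; assumption. }
lra.
Qed.

(** * The function [K] near a common zero and at a first zero *)

Section Positivity.

Variables U U1 W W1 : R -> R.
Hypothesis dU : forall x, is_derive U x (U1 x).
Hypothesis dU1 : forall x, is_derive U1 x (- x * U x).
Hypothesis dW : forall x, is_derive W x (W1 x).
Hypothesis dW1 : forall x, is_derive W1 x (- x * W x).
Hypothesis U1_0 : U1 0 = 0.
Hypothesis W_0 : W 0 = 0.
Hypothesis wronskian_0 : U 0 * W1 0 = 1.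

Ltac derive_tac :=
  auto_derive;
  [ repeat split; eexists; eauto
  | rewrite ?(fun x => is_derive_unique _ _ _ (dU x)), ?(fun x => is_derive_unique _ _ _ (dU1 x)),
      ?(fun x => is_derive_unique _ _ _ (dW x)), ?(fun x => is_derive_unique _ _ _ (dW1 x)) ].

Lemma wronskian_flipped x : U x * W1 x - U1 x * W x = 1.
Proof.
set (w := fun x => U x * W1 x - U1 x * W x).
assert (Hw : forall y, is_derive w y 0).
{ intros y; unfold w; derive_tac; ring. }
assert (w 0 = 1) by (unfold w; rewrite U1_0, wronskian_0; ring).
change (w x = 1).
destruct (Rle_dec 0 x) as [H' | H'].
- rewrite <- (derive_zero_constant w 0 x); auto.
- rewrite (derive_zero_constant w x 0); auto; lra.
Qed.

(** Polarised form of the energy [x y^2 + y'^2] of the equation [y'' = - x y]; its derivative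
    reduces to [U W]. In turn [airy_K] is built to have derivative [3 T], so that signs propagate by
    integration from [U W] to [T] to [K]. *)
Definition airy_T x := x * U x * W x + U1 x * W1 x.
Definition airy_K x := 2 * x * airy_T x + U1 x * W x.

Lemma is_derive_airy_T x : is_derive airy_T x (U x * W x).
Proof. unfold airy_T; derive_tac; ring. Qed.

Lemma is_derive_airy_K x : is_derive airy_K x (3 * airy_T x).
Proof. unfold airy_K, airy_T; derive_tac; ring. Qed.

Lemma is_derive_UW x : is_derive (fun x => U x * W x) x (U1 x * W x + U x * W1 x).
Proof. derive_tac; ring. Qed.

Lemma continuous_UW1 x : continuous (fun x => U1 x * W x + U x * W1 x) x.
Proof.
apply (ex_derive_continuous (V := R_NormedModule)).
eexists; derive_tac; reflexivity.
Qed.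

(** At such a [z] the Wronskian gives [U W1 = 1], so [U W] crosses zero upwards. Integrating from
    [z], [T] is positive on both sides, hence [K] increases through [0]. At [z = 0] this starts the
    positivity of [K]; at a later first zero of [K] it gives a contradiction. *)
Lemma airy_K_sign_near_common_zero z :
  U1 z = 0 -> W z = 0 ->
  exists d : posreal, forall x, Rabs (x - z) < d ->
    (z < x -> 0 < airy_K x) /\ (x < z -> airy_K x < 0).
Proof.
intros HU1 HW.
pose proof (wronskian_flipped z) as Hw; rewrite HU1, HW in Hw.
destruct (continuous_locally_pos _ z (continuous_UW1 z)) as [d Hd].
{ rewrite HU1, HW; lra. }
assert (Tz : airy_T z = 0) by (unfold airy_T; rewrite HU1, HW; ring).
assert (Kz : airy_K z = 0) by (unfold airy_K; rewrite Tz, HW; ring).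
exists d; intros x Hx; split; intros Hxz.
- assert (HUW : forall y, z < y <= x -> 0 < U y * W y).
  { intros y Hy. assert (U z * W z < U y * W y); [| rewrite HW in *; lra].
    apply (derive_pos_increasing (fun x => U x * W x) _ z y is_derive_UW); [lra |].
    intros t Ht; apply Hd; revert Hx; rewrite !Rabs_pos_eq; lra. }
  assert (HT : forall y, z < y <= x -> 0 < airy_T y).
  { intros y Hy; rewrite <- Tz.
    apply (derive_pos_increasing _ _ z y is_derive_airy_T); [lra |].
    intros t Ht; apply HUW; lra. }
  rewrite <- Kz.
  apply (derive_pos_increasing _ _ z x is_derive_airy_K); [lra |].
  intros t Ht; assert (0 < airy_T t) by (apply HT; lra); lra.
- assert (HUW : forall y, x <= y < z -> U y * W y < 0).
  { intros y Hy. assert (U y * W y < U z * W z); [| rewrite HW in *; lra].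
    apply (derive_pos_increasing (fun x => U x * W x) _ y z is_derive_UW); [lra |].
    intros t Ht; apply Hd; revert Hx; rewrite !Rabs_left; lra. }
  assert (HT : forall y, x <= y < z -> 0 < airy_T y).
  { intros y Hy. assert (- airy_T y < - airy_T z); [| lra].
    apply (derive_pos_increasing (fun t => - airy_T t) (fun t => - (U t * W t)) y z); [| lra |].
    - intros t; apply (is_derive_opp (V := R_NormedModule)), is_derive_airy_T.
    - intros t Ht; assert (U t * W t < 0) by (apply HUW; lra); lra. }
  rewrite <- Kz.
  apply (derive_pos_increasing _ _ x z is_derive_airy_K); [lra |].
  intros t Ht; assert (0 < airy_T t) by (apply HT; lra); lra.
Qed.

(* Going back from [z], [U1] and [- W1] cannot both stay positive down to [0], and neither can be
   the first to vanish: [U1 = 0] would give [K < 0], and [W1 = 0] contradicts the Wronskian. *)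
Lemma airy_K_no_first_zero_pos z :
  0 < z -> (forall x, 0 < x < z -> 0 < airy_K x) -> airy_K z = 0 ->
  0 < U1 z -> 0 < W z -> False.
Proof.
intros Hz Kpos Kz HU1 HW.
pose proof (wronskian_flipped z) as Hw.
assert (HQ : 0 < U1 z * W z) by (apply Rmult_lt_0_compat; lra).
assert (HT : airy_T z < 0).
{ unfold airy_K in Kz. destruct (Rlt_le_dec (airy_T z) 0) as [H | H]; [exact H |].
  assert (0 <= z * airy_T z) by (apply Rmult_le_pos; lra). nra. }
unfold airy_T in HT.
(* The Wronskian gives [U W1 = 1 + U1 W > 0] at [z], so [U] and [W1] have the same sign there; if
   both were positive, so would be every term of [T z]. *)
assert (HUz : U z < 0).
{ destruct (Rlt_le_dec (U z) 0) as [H | H]; [exact H | exfalso].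
  assert (0 < U z * W1 z) by lra.
  assert (0 < U z) by (destruct H as [H | H]; [exact H | rewrite <- H in *; lra]).
  assert (0 < W1 z) by nra.
  assert (0 < U1 z * W1 z) by (apply Rmult_lt_0_compat; lra).
  assert (0 < z * U z * W z) by (repeat apply Rmult_lt_0_compat; lra).
  lra. }
assert (HW1z : W1 z < 0) by nra.
assert (cU1 : forall x, continuous U1 x).
{ intros x; apply (ex_derive_continuous (V := R_NormedModule)); eexists; apply dU1. }
assert (cW1 : forall x, continuous (fun x => - W1 x) x).
{ intros x; apply (ex_derive_continuous (V := R_NormedModule)); eexists.
  apply (is_derive_opp (V := R_NormedModule)), dW1. }
(* Going left from [z], as long as [U1 > 0] and [W1 < 0], [U] decreases further below [0] and [W]
   increases further above it. *)
assert (back : forall e, 0 <= e < z -> (forall t, e < t <= z -> 0 < U1 t) ->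
  (forall t, e < t <= z -> W1 t < 0) -> U e < 0 /\ 0 < W e).
{ intros e He H1 H2.
  assert (U e < U z).
  { apply (derive_pos_increasing _ _ e z dU); [lra |]. intros t Ht; apply H1; lra. }
  assert (- W e < - W z).
  { apply (derive_pos_increasing (fun t => - W t) (fun t => - W1 t) e z); [| lra |].
    - intros t; apply (is_derive_opp (V := R_NormedModule)), dW.
    - intros t Ht; assert (W1 t < 0) by (apply H2; lra); lra. }
  lra. }
destruct (last_zero U1 0 z cU1 Hz) as [e [He [He0 Hepos]]]; [lra | exact HU1 |].
destruct (classic (exists t, e <= t < z /\ 0 <= W1 t)) as [[t [Ht Ht']] | Hn].
- destruct (last_zero (fun x => - W1 x) t z cW1) as [s [Hs [Hs0 Hspos]]]; try lra.
  destruct (back s) as [B1 B2]; [lra | | |].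
  + intros x Hx; apply Hepos; lra.
  + intros x Hx; assert (0 < - W1 x) by (apply Hspos; lra); lra.
  + pose proof (wronskian_flipped s) as Hws.
    assert (0 <= U1 s).
    { destruct (Req_dec s e) as [-> | Hse]; [lra | apply Rlt_le, Hepos; lra]. }
    assert (0 <= U1 s * W s) by (apply Rmult_le_pos; lra).
    replace (W1 s) with 0 in Hws by lra. lra.
- assert (HW1 : forall t, e <= t < z -> W1 t < 0).
  { intros t Ht; destruct (Rlt_le_dec (W1 t) 0) as [H | H]; [exact H |].
    exfalso; apply Hn; exists t; split; assumption. }
  destruct (back e) as [B1 B2]; [lra | exact Hepos | |].
  + intros t Ht; destruct (Req_dec t z) as [-> | ]; [exact HW1z | apply HW1; lra].
  (* [e = 0] contradicts [W 0 = 0]; for [e > 0], [U1 e = 0] leaves [K e = 2 e^2 U e W e], which is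
     negative. *)
  + destruct (Req_dec e 0) as [-> | He']; [lra |].
    assert (HK : 0 < airy_K e) by (apply Kpos; lra).
    unfold airy_K, airy_T in HK; rewrite He0 in HK.
    assert (0 < e * e * - U e * W e) by (repeat apply Rmult_lt_0_compat; lra).
    nra.
Qed.

End Positivity.

(** * Positivity of [K] on the half-line and absence of common zeros *)

Section CommonZeros.

Variables U U1 W W1 : R -> R.
Hypothesis dU : forall x, is_derive U x (U1 x).
Hypothesis dU1 : forall x, is_derive U1 x (- x * U x).
Hypothesis dW : forall x, is_derive W x (W1 x).
Hypothesis dW1 : forall x, is_derive W1 x (- x * W x).
Hypothesis U1_0 : U1 0 = 0.
Hypothesis W_0 : W 0 = 0.
Hypothesis wronskian_0 : U 0 * W1 0 = 1.

Let K := airy_K U U1 W W1.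
Let T := airy_T U U1 W W1.

(** At a first zero [z], [K' = 3 T] cannot be positive, so [K z = 0] forces [U1 z * W z >= 0]. If
    this product is [0], [z] is a common zero of [U1] and [W], and [K] would be negative just before
    it. If it is positive, [airy_K_no_first_zero_pos] applies, possibly after negating both
    solutions. *)
Lemma airy_K_pos x : 0 < x -> 0 < K x.
Proof.
intros Hx.
destruct (Rlt_le_dec 0 (K x)) as [H | H]; [exact H | exfalso].
assert (wr := wronskian_flipped U U1 W W1 dU dU1 dW dW1 U1_0 wronskian_0).
assert (near := airy_K_sign_near_common_zero U U1 W W1 dU dU1 dW dW1 U1_0 wronskian_0).
fold K in near.
destruct (near 0 U1_0 W_0) as [d Hd].
pose proof (cond_pos d) as Hdp.
assert (H0 : forall y, 0 < y < d -> 0 < K y).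
{ intros y Hy; apply Hd; [rewrite Rabs_pos_eq |]; lra. }
assert (Hxd : d <= x).
{ destruct (Rle_lt_dec d x); [assumption |]. assert (0 < K x) by (apply H0; lra); lra. }
assert (dK := is_derive_airy_K U U1 W W1 dU dU1 dW dW1).
assert (dT := is_derive_airy_T U U1 W W1 dU dU1 dW dW1).
fold K in dK; fold T in dK, dT.
destruct (first_zero K (d / 2) x) as [z [Hz [Kz Hpos]]].
{ intros y; apply (ex_derive_continuous (V := R_NormedModule)); eexists; apply dK. }
{ lra. }
{ apply H0; lra. }
{ exact H. }
assert (Kpos : forall y, 0 < y < z -> 0 < K y).
{ intros y Hy; destruct (Rlt_le_dec y d); [apply H0 | apply Hpos]; lra. }
assert (HT : T z <= 0).
{ destruct (Rle_lt_dec (T z) 0) as [HT | HT]; [exact HT | exfalso].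
  destruct (continuous_locally_pos T z) as [e He].
  { apply (ex_derive_continuous (V := R_NormedModule)); eexists; apply dT. }
  { exact HT. }
  pose proof (cond_pos e) as Hep.
  pose proof (Rmax_l (d / 2) (z - e / 2)); pose proof (Rmax_r (d / 2) (z - e / 2)).
  assert (Rmax (d / 2) (z - e / 2) < z) by (apply Rmax_lub_lt; lra).
  set (y := Rmax (d / 2) (z - e / 2)) in *.
  assert (0 < K y) by (apply Kpos; lra).
  assert (K y < K z); [| lra].
  apply (derive_pos_increasing _ _ y z dK); [lra |].
  intros t Ht; assert (0 < T t) by (apply He; rewrite Rabs_left; lra); lra. }
assert (KE : K z = 2 * (z * T z) + U1 z * W z) by (unfold K, T, airy_K; ring).
assert (HzT : z * T z <= 0) by nra.
pose proof (wr z) as Hw.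
destruct (Req_dec (U1 z * W z) 0) as [HQ | HQ].
- assert (HTz : T z = 0) by nra.
  unfold T, airy_T in HTz.
  (* The Wronskian is now [U W1 = 1], so neither [U] nor [W1] vanishes; once one of [U1], [W] is
     [0], [T z = 0] therefore makes the other one vanish. *)
  assert (HUW : U1 z = 0 /\ W z = 0).
  { assert (U z <> 0) by (intros E; rewrite E in Hw; lra).
    assert (W1 z <> 0) by (intros E; rewrite E in Hw; lra).
    destruct (Rmult_integral _ _ HQ) as [E | E]; rewrite E in HTz; split; trivial.
    - assert (E' : z * (U z * W z) = 0) by lra.
      apply Rmult_integral in E'; destruct E' as [E' | E']; [lra |].
      apply Rmult_integral in E'; tauto.
    - assert (E' : U1 z * W1 z = 0) by lra.
      apply Rmult_integral in E'; tauto. }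
  destruct (near z (proj1 HUW) (proj2 HUW)) as [e He].
  pose proof (cond_pos e) as Hep.
  pose proof (Rmax_l (d / 2) (z - e / 2)); pose proof (Rmax_r (d / 2) (z - e / 2)).
  assert (Rmax (d / 2) (z - e / 2) < z) by (apply Rmax_lub_lt; lra).
  set (y := Rmax (d / 2) (z - e / 2)) in *.
  assert (0 < K y) by (apply Kpos; lra).
  assert (K y < 0) by (apply He; [rewrite Rabs_left |]; lra).
  lra.
- assert (HQp : 0 < U1 z * W z) by lra.
  destruct (Rlt_le_dec 0 (U1 z)) as [HU | HU].
  + apply (airy_K_no_first_zero_pos U U1 W W1 dU dU1 dW dW1 U1_0 W_0 wronskian_0 z);
      trivial; [lra | nra].
  + assert (HU0 : U1 z < 0).
    { destruct HU as [HU | HU]; [exact HU | rewrite HU in HQp; lra]. }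
    (* [K] and the Wronskian are bilinear in the two solutions, so negating both changes neither. *)
    assert (HKo : forall y, airy_K (fun x => - U x) (fun x => - U1 x) (fun x => - W x)
      (fun x => - W1 x) y = K y) by (intros; unfold K, airy_K, airy_T; ring).
    apply (airy_K_no_first_zero_pos (fun x => - U x) (fun x => - U1 x)
      (fun x => - W x) (fun x => - W1 x)) with (z := z); try lra; trivial.
    * intros y; apply (is_derive_opp (V := R_NormedModule)), dU.
    * intros y; replace (- y * - U y) with (- (- y * U y)) by ring.
      apply (is_derive_opp (V := R_NormedModule)), dU1.
    * intros y; apply (is_derive_opp (V := R_NormedModule)), dW.
    * intros y; replace (- y * - W y) with (- (- y * W y)) by ring.
      apply (is_derive_opp (V := R_NormedModule)), dW1.
    * intros y Hy; rewrite HKo; auto.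
    * now rewrite HKo.
    * destruct (Rlt_le_dec (W z) 0) as [HWz | HWz]; [lra | nra].
Qed.

Lemma no_common_zero_U1_W x : 0 < x -> U1 x = 0 -> W x = 0 -> False.
Proof.
intros Hx H1 H2; pose proof (airy_K_pos x Hx) as H.
unfold K, airy_K, airy_T in H; rewrite H1, H2 in H; lra.
Qed.

Lemma no_common_zero_U_W1 x : 0 < x -> U x = 0 -> W1 x = 0 -> False.
Proof.
intros Hx H1 H2; pose proof (airy_K_pos x Hx) as H.
assert (wr := wronskian_flipped U U1 W W1 dU dU1 dW dW1 U1_0 wronskian_0 x).
unfold K, airy_K, airy_T in H; rewrite H1, H2 in *; lra.
Qed.

End CommonZeros.

(** * Derivatives relative to an interval, and gluing at the origin *)

Definition is_derive_within (a b : R) (f : R -> R) (x l : R) : Prop :=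
  forall eps, 0 < eps -> exists d, 0 < d /\ forall y, a <= y <= b -> Rabs (y - x) < d ->
    Rabs (f y - f x - (y - x) * l) <= eps * Rabs (y - x).

Lemma is_derive_on_components (a b : R) (f : R -> C) (x : R) (l : C) :
  a <= x <= b -> is_derive_on a b f x l ->
  is_derive_within a b (fun y => fst (f y)) x (fst l) /\
  is_derive_within a b (fun y => snd (f y)) x (snd l).
Proof.
intros Hx [_ Hf].
assert (Hlim : is_filter_lim (within (fun y => a <= y <= b) (locally x)) x).
{ intros P [d Hd]. exists d; intros y Hy _; apply Hd, Hy. }
specialize (Hf x Hlim).
assert (Hnorm : forall z : C_R_NormedModule,
  Rabs (fst z) <= norm z /\ Rabs (snd z) <= norm z).
{ intros z; destruct (sqrt_plus_sqr (Rabs (fst z)) (Rabs (snd z))) as [H _].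
  rewrite !Rabs_Rabsolu in H.
  split; (eapply Rle_trans; [| exact H]); [apply Rmax_l | apply Rmax_r]. }
split; intros eps Heps; destruct (Hf (mkposreal eps Heps)) as [d Hd];
  exists d; (split; [apply cond_pos |]); intros y Hy Hyd; specialize (Hd y Hyd Hy);
  (eapply Rle_trans; [| exact Hd]).
- exact (proj1 (Hnorm (minus (minus (f y) (f x)) (scal (minus y x) l)))).
- exact (proj2 (Hnorm (minus (minus (f y) (f x)) (scal (minus y x) l)))).
Qed.

Lemma is_derive_on_RtoC (a b : R) (f : R -> R) (x l : R) :
  a <= x <= b -> is_derive f x l -> is_derive_on a b (fun y => RtoC (f y)) x (RtoC l).
Proof.
intros Hx [_ Hf]; split.
- apply (is_linear_scal_l (K := R_AbsRing) (V := C_R_NormedModule)).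
- intros z Hz.
  (* [filterdiff] asks for the estimate at every limit [z] of the relative filter. As [x] lies in
     the interval, it belongs to every ball around [z]. *)
  assert (x = z) as <-.
  { destruct (Req_dec x z) as [| Hxz]; [assumption | exfalso].
    assert (Hp : 0 < Rabs (x - z)) by (apply Rabs_pos_lt; lra).
    destruct (Hz _ (locally_ball z (mkposreal _ Hp))) as [d Hd].
    apply (Rlt_irrefl (Rabs (x - z))).
    exact (Hd x (ball_center x d) Hx). }
  intros eps; destruct (Hf x (fun P H => H) eps) as [d Hd].
  exists d; intros y Hy _; specialize (Hd y Hy).
  eapply Rle_trans; [| exact Hd].
  assert (Hnorm : forall r : R, norm (RtoC r : C_R_NormedModule) = Rabs r).
  { intros r; transitivity (sqrt (Rabs r ^ 2 + Rabs 0 ^ 2)); [reflexivity |].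
    rewrite Rabs_R0, pow_i, Rplus_0_r by auto.
    apply sqrt_pow2, Rabs_pos. }
  apply Req_le.
  transitivity (norm (RtoC (f y - f x - (y - x) * l) : C_R_NormedModule)).
  + f_equal; apply injective_projections; simpl;
      unfold minus, plus, opp, scal; simpl; unfold mult; simpl; ring.
  + rewrite Hnorm; reflexivity.
Qed.

(** Continuing [f] along its tangent lines at [a] and [b] turns the one-sided derivatives there into
    two-sided ones, so that ordinary calculus applies up to the endpoints. The map [p] below
    projects onto [[a, b]]. *)
Lemma is_derive_extension (a b : R) (f f' : R -> R) :
  a < b -> (forall x, a <= x <= b -> is_derive_within a b f x (f' x)) ->
  exists F, forall x, a <= x <= b -> F x = f x /\ is_derive F x (f' x).
Proof.
intros Hab Hf.
set (p := fun y => Rmax a (Rmin b y)).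
assert (p_in : forall x, a <= x <= b -> p x = x).
{ intros x Hx; unfold p; rewrite Rmin_right, Rmax_right; lra. }
assert (p_lo : forall x, x <= a -> p x = a).
{ intros x Hx; unfold p; rewrite Rmin_right, Rmax_left; lra. }
assert (p_hi : forall x, b <= x -> p x = b).
{ intros x Hx; unfold p; rewrite Rmin_left, Rmax_right; lra. }
exists (fun y => f (p y) + (y - p y) * f' (p y)).
intros x Hx; split; [rewrite p_in by exact Hx; ring |].
apply is_derive_Reals; intros eps Heps.
destruct (Hf x Hx (eps / 2)) as [d [Hd0 Hd]]; [lra |].
(* A step shorter than [d'] can leave [[a, b]] only when [x] is the endpoint being crossed, where
   the extension is exactly affine. *)
assert (Hd' : exists d', 0 < d' <= d /\ (a < x -> d' <= x - a) /\ (x < b -> d' <= b - x)).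
{ exists (Rmin d (Rmin (if Rlt_dec a x then x - a else 1) (if Rlt_dec x b then b - x else 1))).
  split; [split |split; intros].
  - repeat apply Rmin_glb_lt; try destruct Rlt_dec; lra.
  - apply Rmin_l.
  - rewrite Rmin_comm. eapply Rle_trans; [apply Rmin_l |]. eapply Rle_trans; [apply Rmin_l |].
    destruct Rlt_dec; lra.
  - rewrite Rmin_comm. eapply Rle_trans; [apply Rmin_l |]. eapply Rle_trans; [apply Rmin_r |].
    destruct Rlt_dec; lra. }
destruct Hd' as [d' [[Hd'0 Hd'd] [Ha Hb]]].
exists (mkposreal d' Hd'0); intros h Hh Hhd; simpl in Hhd.
rewrite (p_in x Hx).
assert (Habs : 0 < Rabs h) by (apply Rabs_pos_lt, Hh).
apply Rmult_lt_reg_r with (1 := Habs).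
rewrite <- Rabs_mult.
set (D := (f (p (x + h)) + (x + h - p (x + h)) * f' (p (x + h)) - (f x + (x - x) * f' x))).
replace ((D / h - f' x) * h) with (D - h * f' x) by (field; exact Hh).
apply Rle_lt_trans with (eps / 2 * Rabs h); [| nra].
assert (Hh1 := Rle_abs h); assert (Hh2 := Rle_abs (- h)); rewrite Rabs_Ropp in Hh2.
unfold D.
destruct (Rlt_le_dec (x + h) a) as [H1 | H1]; [| destruct (Rlt_le_dec b (x + h)) as [H2 | H2]].
- replace x with a in *; [| destruct (Rle_lt_dec x a); [lra | specialize (Ha ltac:(lra)); lra]].
  rewrite p_lo by lra.
  match goal with |- Rabs ?t <= _ => replace t with 0 by ring end.
  rewrite Rabs_R0; nra.
- replace x with b in *; [| destruct (Rle_lt_dec b x); [lra | specialize (Hb ltac:(lra)); lra]].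
  rewrite p_hi by lra.
  match goal with |- Rabs ?t <= _ => replace t with 0 by ring end.
  rewrite Rabs_R0; nra.
- rewrite p_in by lra.
  specialize (Hd (x + h) ltac:(lra)).
  replace (x + h - x) with h in Hd by ring.
  match goal with |- Rabs ?t <= _ => replace t with (f (x + h) - f x - h * f' x) by ring end.
  apply Hd; lra.
Qed.

Definition glue (g h : R -> R) (x : R) : R := if Rle_dec x 0 then g x else h x.

Lemma is_derive_glue (g h g' h' : R -> R) :
  (forall x, is_derive g x (g' x)) -> (forall x, is_derive h x (h' x)) ->
  g 0 = h 0 -> g' 0 = h' 0 ->
  forall x, is_derive (glue g h) x (glue g' h' x).
Proof.
intros Hg Hh E E' x.
unfold glue at 2.
destruct (Rtotal_order x 0) as [Hx | [-> | Hx]].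
- destruct (Rle_dec x 0) as [_ | H]; [| lra].
  apply (is_derive_ext_loc g); [| apply Hg].
  assert (Hp : 0 < - x) by lra.
  exists (mkposreal _ Hp); intros y Hy; unfold glue.
  change (Rabs (y - x) < - x) in Hy; apply Rabs_def2 in Hy.
  destruct (Rle_dec y 0); [reflexivity | lra].
- destruct (Rle_dec 0 0) as [_ | H]; [| lra].
  apply is_derive_Reals; intros eps Heps.
  destruct (proj1 (is_derive_Reals _ _ _) (Hg 0) eps Heps) as [d1 H1].
  destruct (proj1 (is_derive_Reals _ _ _) (Hh 0) eps Heps) as [d2 H2].
  exists (mkposreal _ (Rmin_stable_in_posreal d1 d2)); simpl; intros t Ht Htd.
  pose proof (Rmin_l d1 d2); pose proof (Rmin_r d1 d2).
  unfold glue; destruct (Rle_dec 0 0) as [_ | H']; [| lra].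
  destruct (Rle_dec (0 + t) 0).
  + apply H1; [exact Ht | lra].
  + rewrite E, E'; apply H2; [exact Ht | lra].
- destruct (Rle_dec x 0) as [H | _]; [lra |].
  apply (is_derive_ext_loc h); [| apply Hh].
  exists (mkposreal _ Hx); intros y Hy; unfold glue.
  change (Rabs (y - x) < x) in Hy; apply Rabs_def2 in Hy.
  destruct (Rle_dec y 0); [lra | reflexivity].
Qed.

(** * Airy modes of the triangular well at energy [0] *)

Definition sgn (b : bool) : R := if b then 1 else - 1.

Section Well.

Variables u u1 v v1 : R -> R.
Hypothesis du : forall x, is_derive u x (u1 x).
Hypothesis du1 : forall x, is_derive u1 x (x * u x).
Hypothesis dv : forall x, is_derive v x (v1 x).
Hypothesis dv1 : forall x, is_derive v1 x (x * v x).
Hypothesis u_0 : u 0 = 1.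
Hypothesis u1_0 : u1 0 = 0.
Hypothesis v_0 : v 0 = 0.
Hypothesis v1_0 : v1 0 = 1.

(** Reflection turns [y'' = x y] into [y'' = - x y], the equation of the positivity argument; the
    sign in [W] makes [W1 0 = 1]. *)
Let U x := u (- x).
Let U1 x := - u1 (- x).
Let W x := - v (- x).
Let W1 x := v1 (- x).

Lemma is_derive_reflect (f f' : R -> R) :
  (forall x, is_derive f x (f' x)) -> forall x, is_derive (fun x => f (- x)) x (- f' (- x)).
Proof.
intros Hf x.
replace (- f' (- x)) with (scal (- 1) (f' (- x))) by (unfold scal; simpl; unfold mult; simpl; ring).
apply (is_derive_comp f); [apply Hf |].
auto_derive; [exact I | ring].
Qed.

Lemma is_derive_U x : is_derive U x (U1 x).
Proof. apply is_derive_reflect, du. Qed.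

Lemma is_derive_U1 x : is_derive U1 x (- x * U x).
Proof.
replace (- x * U x) with (- - (- x * u (- x))) by (unfold U; ring).
apply (is_derive_opp (V := R_NormedModule)), (is_derive_reflect _ _ du1).
Qed.

Lemma is_derive_W x : is_derive W x (W1 x).
Proof.
unfold W1; rewrite <- (Ropp_involutive (v1 (- x))).
apply (is_derive_opp (V := R_NormedModule)), (is_derive_reflect _ _ dv).
Qed.

Lemma is_derive_W1 x : is_derive W1 x (- x * W x).
Proof.
replace (- x * W x) with (- (- x * v (- x))) by (unfold W; ring).
apply (is_derive_reflect _ _ dv1).
Qed.

Lemma U1_0 : U1 0 = 0.
Proof. unfold U1; rewrite Ropp_0, u1_0; ring. Qed.

Lemma W_0 : W 0 = 0.
Proof. unfold W; rewrite Ropp_0, v_0; ring. Qed.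

Lemma UW1_0 : U 0 * W1 0 = 1.
Proof. unfold U, W1; rewrite Ropp_0, u_0, v1_0; ring. Qed.

Lemma airy_wronskian x : u x * v1 x - u1 x * v x = 1.
Proof.
rewrite <- (wronskian_flipped U U1 W W1 is_derive_U is_derive_U1 is_derive_W is_derive_W1
  U1_0 UW1_0 (- x)).
unfold U, U1, W, W1; rewrite Ropp_involutive; ring.
Qed.

Lemma no_common_zero_u1_v x : x < 0 -> u1 x = 0 -> v x <> 0.
Proof.
intros Hx H1 H2.
apply (no_common_zero_U1_W U U1 W W1 is_derive_U is_derive_U1 is_derive_W is_derive_W1
  U1_0 W_0 UW1_0 (- x)); [lra | |];
  unfold U1, W; rewrite Ropp_involutive; lra.
Qed.

Lemma no_common_zero_u_v1 x : x < 0 -> u x = 0 -> v1 x <> 0.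
Proof.
intros Hx H1 H2.
apply (no_common_zero_U_W1 U U1 W W1 is_derive_U is_derive_U1 is_derive_W is_derive_W1
  U1_0 W_0 UW1_0 (- x)); [lra | |];
  unfold U, W1; rewrite Ropp_involutive; lra.
Qed.

Variables k L : R.
Hypothesis k_pos : 0 < k.
Hypothesis L_pos : 0 < L.

(** The real eigenvalue problem at energy [0], divided by [hbar ^ 2 / (2 * m)]. Derivatives are
    two-sided even at the endpoints, since solutions get extended past them. *)
Definition well_solution (s : R) (p p1 : R -> R) : Prop :=
  (forall x, - L <= x <= L -> is_derive p x (p1 x)) /\
  (forall x, - L <= x <= L -> is_derive p1 x (k ^ 3 * (Rabs x - L) * p x)) /\
  p L = s * p (- L) /\ p1 L = s * p1 (- L).

Lemma is_derive_scaled_airy (y y1 : R -> R) :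
  (forall x, is_derive y x (y1 x)) -> (forall x, is_derive y1 x (x * y x)) ->
  (forall x, is_derive (fun x => y (k * (x - L))) x (k * y1 (k * (x - L)))) /\
  (forall x, is_derive (fun x => k * y1 (k * (x - L))) x (k ^ 3 * (x - L) * y (k * (x - L)))).
Proof.
intros Hy Hy1; split; intros x.
- apply (is_derive_comp y (fun x => k * (x - L))); [apply Hy |].
  auto_derive; [exact I | ring].
- replace (k ^ 3 * (x - L) * y (k * (x - L))) with
    (scal k (scal k (k * (x - L) * y (k * (x - L)))))
    by (unfold scal; simpl; unfold mult; simpl; ring).
  apply is_derive_scal.
  apply (is_derive_comp y1 (fun x => k * (x - L))); [apply Hy1 |].
  auto_derive; [exact I | ring].
Qed.

(** The Wronskians of [g] with the two rescaled Airy functions are constant and can be read off at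
    [L], where the Airy argument is [0]. Cramer's rule, with determinant given by [airy_wronskian],
    then recovers [g] and [g1]. *)
Lemma half_well_representation (g g1 : R -> R) :
  (forall x, 0 <= x <= L -> is_derive g x (g1 x)) ->
  (forall x, 0 <= x <= L -> is_derive g1 x (k ^ 3 * (x - L) * g x)) ->
  forall x, 0 <= x <= L ->
    g x = g L * u (k * (x - L)) + g1 L / k * v (k * (x - L)) /\
    g1 x = k * g L * u1 (k * (x - L)) + g1 L * v1 (k * (x - L)).
Proof.
intros Hg Hg1.
destruct (is_derive_scaled_airy u u1 du du1) as [Hu Hu1].
destruct (is_derive_scaled_airy v v1 dv dv1) as [Hv Hv1].
set (ux := fun x => u (k * (x - L))) in *; set (vx := fun x => v (k * (x - L))) in *.
set (u1x := fun x => k * u1 (k * (x - L))) in *; set (v1x := fun x => k * v1 (k * (x - L))) in *.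
assert (wronskian_constant : forall f f1 : R -> R, (forall x, is_derive f x (f1 x)) ->
  (forall x, is_derive f1 x (k ^ 3 * (x - L) * f x)) ->
  forall x, 0 <= x <= L -> g x * f1 x - g1 x * f x = g L * f1 L - g1 L * f L).
{ intros f f1 Hf Hf1 x Hx.
  apply (derive_zero_constant (fun x => g x * f1 x - g1 x * f x)); [lra |].
  intros z Hz. assert (Hgz := Hg z ltac:(lra)); assert (Hg1z := Hg1 z ltac:(lra)).
  specialize (Hf z); specialize (Hf1 z).
  auto_derive; [repeat split; eexists; eassumption |].
  rewrite (is_derive_unique (fun x : R => g x) _ _ Hgz),
    (is_derive_unique (fun x : R => g1 x) _ _ Hg1z),
    (is_derive_unique (fun x : R => f x) _ _ Hf),
    (is_derive_unique (fun x : R => f1 x) _ _ Hf1); ring. }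
intros x Hx.
assert (A := wronskian_constant vx v1x Hv Hv1 x Hx).
assert (B := wronskian_constant ux u1x Hu Hu1 x Hx).
unfold ux, u1x, vx, v1x in A, B.
replace (k * (L - L)) with 0 in A, B by ring.
rewrite u_0, u1_0 in B; rewrite v_0, v1_0 in A.
assert (w := airy_wronskian (k * (x - L))).
set (a := u (k * (x - L))) in *; set (b := v (k * (x - L))) in *.
set (a1 := u1 (k * (x - L))) in *; set (b1 := v1 (k * (x - L))) in *.
split.
- apply (Rmult_eq_reg_l k); [| lra].
  transitivity (k * (g x * (a * b1 - a1 * b))); [rewrite w; ring |].
  transitivity (a * (g x * (k * b1) - g1 x * b) - b * (g x * (k * a1) - g1 x * a)); [ring |].
  rewrite A, B; field; lra.
- transitivity (g1 x * (a * b1 - a1 * b)); [rewrite w; ring |].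
  transitivity (a1 * (g x * (k * b1) - g1 x * b) - b1 * (g x * (k * a1) - g1 x * a)); [ring |].
  rewrite A, B; ring.
Qed.

Definition airy_fun (b : bool) : R -> R := if b then u else v.
Definition airy_fun' (b : bool) : R -> R := if b then u1 else v1.

(* [bs] encodes the boundary condition (periodic for [true]) and [sg] the parity in [x] (even for
   [true]).  Together they force the derivative at [L] (if [bs = sg]) or the value at [L] to vanish,
   so the mode is [u], resp. [v], of [k (x - L)] on [[0, L]]; parity then asks that [matching bs sg]
   vanish. *)
Definition matching (bs sg : bool) : R :=
  if sg then airy_fun' (Bool.eqb bs sg) (- (k * L)) else airy_fun (Bool.eqb bs sg) (- (k * L)).

Definition half_mode (bs sg : bool) (x : R) : R := airy_fun (Bool.eqb bs sg) (k * (x - L)).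
Definition half_mode' (bs sg : bool) (x : R) : R := k * airy_fun' (Bool.eqb bs sg) (k * (x - L)).

(** Continuation of the half mode to the left with parity [sg]. The two pieces fit to first order at
    [0] when [matching bs sg = 0]. *)
Definition mode (bs sg : bool) : R -> R :=
  glue (fun x => sgn sg * half_mode bs sg (- x)) (half_mode bs sg).
Definition mode' (bs sg : bool) : R -> R :=
  glue (fun x => - sgn sg * half_mode' bs sg (- x)) (half_mode' bs sg).

Lemma half_mode_derive bs sg :
  (forall x, is_derive (half_mode bs sg) x (half_mode' bs sg x)) /\
  (forall x, is_derive (half_mode' bs sg) x (k ^ 3 * (x - L) * half_mode bs sg x)).
Proof.
unfold half_mode, half_mode'.
destruct (Bool.eqb bs sg); simpl; apply is_derive_scaled_airy; assumption.
Qed.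

Lemma matching_0 bs sg :
  matching bs sg = 0 ->
  sgn sg * half_mode bs sg 0 = half_mode bs sg 0 /\
  - sgn sg * half_mode' bs sg 0 = half_mode' bs sg 0.
Proof.
unfold matching, half_mode, half_mode'.
replace (k * (0 - L)) with (- (k * L)) by ring.
destruct sg; simpl; intros ->; split; ring.
Qed.

Lemma mode_well_solution bs sg :
  matching bs sg = 0 -> well_solution (sgn bs) (mode bs sg) (mode' bs sg).
Proof.
intros Hm; destruct (matching_0 bs sg Hm) as [E0 E1].
destruct (half_mode_derive bs sg) as [D D1].
assert (Hopp : - 0 = 0) by ring.
split; [| split; [| split]].
- intros x _; apply is_derive_glue; [| exact D | now rewrite Hopp | now rewrite Hopp].
  intros t; replace (- sgn sg * half_mode' bs sg (- t)) with
    (scal (sgn sg) (- half_mode' bs sg (- t)))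
    by (unfold scal; simpl; unfold mult; simpl; ring).
  apply is_derive_scal, (is_derive_reflect _ _ D).
- intros x _.
  (* On the left [Rabs x] is [- x], so the right-hand side is itself glued from the second
     derivatives of the two pieces. *)
  replace (k ^ 3 * (Rabs x - L) * mode bs sg x) with
    (glue (fun x => k ^ 3 * (- x - L) * (sgn sg * half_mode bs sg (- x)))
          (fun x => k ^ 3 * (x - L) * half_mode bs sg x) x).
  2: { unfold mode, glue; destruct (Rle_dec x 0).
       - rewrite Rabs_left1 by lra; ring.
       - rewrite Rabs_pos_eq by lra; ring. }
  apply is_derive_glue; [| exact D1 | now rewrite Hopp | rewrite Hopp, E0; ring].
  intros t; replace (k ^ 3 * (- t - L) * (sgn sg * half_mode bs sg (- t))) with
    (scal (- sgn sg) (- (k ^ 3 * (- t - L) * half_mode bs sg (- t))))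
    by (unfold scal; simpl; unfold mult; simpl; ring).
  apply is_derive_scal, (is_derive_reflect _ _ D1).
(* At both ends the Airy argument is [0]. If [bs = sg], parity gives the condition on values and
   [u1 0 = 0] the one on derivatives; otherwise [v 0 = 0] gives the former and parity the latter. *)
- unfold mode, glue; destruct (Rle_dec L 0); [lra |]; destruct (Rle_dec (- L) 0); [| lra].
  unfold half_mode; rewrite Ropp_involutive; replace (k * (L - L)) with 0 by ring.
  destruct bs, sg; simpl; rewrite ?v_0; ring.
- unfold mode', glue; destruct (Rle_dec L 0); [lra |]; destruct (Rle_dec (- L) 0); [| lra].
  unfold half_mode'; rewrite Ropp_involutive; replace (k * (L - L)) with 0 by ring.
  destruct bs, sg; simpl; rewrite ?u1_0; ring.
Qed.

(** As the potential is even, [g], twice a parity part of [p], solves the same equation on [[0, L]].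
    The boundary condition kills [g1 L] or [g L], leaving a single Airy function in the
    representation, and parity at [0] gives the matching equation. *)
Lemma parity_part bs sg (p p1 : R -> R) :
  well_solution (sgn bs) p p1 ->
  exists a, a * matching bs sg = 0 /\
    forall x, 0 <= x <= L -> p x + sgn sg * p (- x) = a * half_mode bs sg x.
Proof.
intros (Hp & Hp1 & E & E1).
set (g := fun x => p x + sgn sg * p (- x)).
set (g1 := fun x => p1 x - sgn sg * p1 (- x)).
assert (rep : forall x, 0 <= x <= L ->
    g x = g L * u (k * (x - L)) + g1 L / k * v (k * (x - L)) /\
    g1 x = k * g L * u1 (k * (x - L)) + g1 L * v1 (k * (x - L))).
{ apply half_well_representation.
  - intros x Hx; unfold g, g1.
    assert (H1 := Hp x ltac:(lra)); assert (H2 := Hp (- x) ltac:(lra)).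
    auto_derive; [repeat split; eexists; eassumption |].
    rewrite (is_derive_unique (fun x : R => p x) _ _ H1),
      (is_derive_unique (fun x : R => p x) _ _ H2); ring.
  - intros x Hx; unfold g, g1.
    assert (H1 := Hp1 x ltac:(lra)); assert (H2 := Hp1 (- x) ltac:(lra)).
    rewrite Rabs_Ropp in H2; rewrite Rabs_pos_eq in H1, H2 by lra.
    auto_derive; [repeat split; eexists; eassumption |].
    rewrite (is_derive_unique (fun x : R => p1 x) _ _ H1),
      (is_derive_unique (fun x : R => p1 x) _ _ H2); ring. }
assert (g0 : sg = false -> g 0 = 0) by (intros ->; unfold g; simpl; rewrite Ropp_0; ring).
assert (g10 : sg = true -> g1 0 = 0) by (intros ->; unfold g1; simpl; rewrite Ropp_0; ring).
destruct (rep 0) as [R0 R1]; [lra |].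
replace (k * (0 - L)) with (- (k * L)) in R0, R1 by ring.
unfold matching, half_mode, airy_fun, airy_fun'.
destruct (Bool.eqb bs sg) eqn:Hb.
- assert (Hg1L : g1 L = 0).
  { apply Bool.eqb_prop in Hb; subst sg; unfold g1; rewrite E1.
    destruct bs; simpl; ring. }
  rewrite Hg1L in *.
  exists (g L); split.
  + destruct sg; [rewrite g10 in R1 by reflexivity | rewrite g0 in R0 by reflexivity].
    * apply (Rmult_eq_reg_l k); lra.
    * unfold Rdiv in R0; lra.
  + intros x Hx; change (g x = g L * u (k * (x - L))).
    destruct (rep x Hx) as [-> _]; unfold Rdiv; ring.
- assert (HgL : g L = 0).
  { unfold g; rewrite E; destruct bs, sg; try discriminate; simpl; ring. }
  rewrite HgL in *.
  exists (g1 L / k); split.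
  + destruct sg; [rewrite g10 in R1 by reflexivity | rewrite g0 in R0 by reflexivity].
    * replace (g1 L / k * v1 (- (k * L))) with (g1 L * v1 (- (k * L)) / k) by (field; lra).
      replace (g1 L * v1 (- (k * L))) with 0 by lra. unfold Rdiv; ring.
    * lra.
  + intros x Hx; change (g x = g1 L / k * v (k * (x - L))).
    destruct (rep x Hx) as [-> _]; ring.
Qed.

Lemma well_solution_decomposition bs (p p1 : R -> R) :
  well_solution (sgn bs) p p1 ->
  exists a : bool -> R, (forall sg, a sg * matching bs sg = 0) /\
    forall x, - L <= x <= L -> p x = a true * mode bs true x + a false * mode bs false x.
Proof.
intros Hp.
destruct (parity_part bs true p p1 Hp) as [a [Ha Ea]].
destruct (parity_part bs false p p1 Hp) as [b [Hb Eb]].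
exists (fun sg : bool => (if sg then a else b) / 2); split.
- intros []; [apply (Rmult_eq_reg_l 2) | apply (Rmult_eq_reg_l 2)]; lra.
- intros x Hx; unfold mode, glue; simpl in Ea, Eb |- *.
  destruct (Rle_dec x 0).
  + assert (H1 := Ea (- x) ltac:(lra)); assert (H2 := Eb (- x) ltac:(lra)).
    rewrite Ropp_involutive in H1, H2; lra.
  + assert (H1 := Ea x ltac:(lra)); assert (H2 := Eb x ltac:(lra)); lra.
Qed.

(** Otherwise an Airy function and its derivative would vanish together at the point corresponding
    to [L / 2], against the Wronskian. *)
Lemma mode_nontrivial bs sg : exists x, - L <= x <= L /\ mode bs sg x <> 0.
Proof.
destruct (classic (exists x, - L <= x <= L /\ mode bs sg x <> 0)) as [H | H]; [exact H | exfalso].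
assert (Z : forall x, 0 < x < L -> half_mode bs sg x = 0).
{ intros x Hx; destruct (Req_dec (half_mode bs sg x) 0) as [E | E]; [exact E |].
  exfalso; apply H; exists x; split; [lra |]; unfold mode, glue.
  destruct (Rle_dec x 0); [lra | exact E]. }
destruct (half_mode_derive bs sg) as [D _].
assert (Z1 : half_mode' bs sg (L / 2) = 0).
{ rewrite <- (is_derive_unique _ _ _ (D (L / 2))).
  apply is_derive_unique, (is_derive_ext_loc (fun _ => 0)).
  - assert (HL : 0 < L / 2) by lra.
    exists (mkposreal _ HL); intros y Hy; symmetry; apply Z.
    change (Rabs (y - L / 2) < L / 2) in Hy; apply Rabs_def2 in Hy; lra.
  - apply (is_derive_const (V := R_NormedModule)). }
assert (Z0 := Z (L / 2) ltac:(lra)).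
assert (w := airy_wronskian (k * (L / 2 - L))).
unfold half_mode, half_mode' in Z0, Z1.
apply Rmult_integral in Z1; destruct Z1 as [Z1 | Z1]; [lra |].
destruct (Bool.eqb bs sg); simpl in Z0, Z1; rewrite Z0, Z1 in w; lra.
Qed.

End Well.

(** * Dimension of the eigenspaces at energy [0] *)

Section Spectrum.

Variables (hbar m L V0 k : R) (V : R -> R).
Hypothesis hbar_pos : 0 < hbar.
Hypothesis m_pos : 0 < m.
Hypothesis L_pos : 0 < L.
Hypothesis k_pos : 0 < k.
Hypothesis k_cubed : hbar ^ 2 / (2 * m) * k ^ 3 = V0 / L.
Hypothesis V_def : triangular_potential L V0 V.

Lemma eigenspace_of_well_solution (s : R) (p p1 : R -> R) :
  well_solution k L s p p1 -> eigenspace hbar m L V s 0 (fun x => RtoC (p x)).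
Proof.
intros (Hp & Hp1 & E & E1).
exists (fun x => RtoC (p1 x)), (fun x => RtoC (k ^ 3 * (Rabs x - L) * p x)).
split; [| split; [| split; [| split]]].
- intros x Hx; apply is_derive_on_RtoC; auto.
- intros x Hx; apply is_derive_on_RtoC; auto.
- intros x Hx; rewrite <- !RtoC_mult, <- RtoC_plus; f_equal.
  rewrite (proj2 V_def x Hx).
  replace (- (hbar ^ 2 / (2 * m)) * (k ^ 3 * (Rabs x - L) * p x)) with
    (- (hbar ^ 2 / (2 * m) * k ^ 3) * ((Rabs x - L) * p x)) by ring.
  rewrite k_cubed; field; lra.
- rewrite <- RtoC_mult; now f_equal.
- rewrite <- RtoC_mult; now f_equal.
Qed.

Lemma well_solution_extension (s : R) (f f1 f2 : R -> R) :
  (forall x, - L <= x <= L -> is_derive_within (- L) L f x (f1 x)) ->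
  (forall x, - L <= x <= L -> is_derive_within (- L) L f1 x (f2 x)) ->
  (forall x, - L <= x <= L -> - (hbar ^ 2 / (2 * m)) * f2 x + V x * f x = 0) ->
  f L = s * f (- L) -> f1 L = s * f1 (- L) ->
  exists p p1, well_solution k L s p p1 /\ forall x, - L <= x <= L -> f x = p x.
Proof.
intros H H1 Heq E E1.
destruct (is_derive_extension (- L) L f f1 ltac:(lra) H) as [p Hp].
destruct (is_derive_extension (- L) L f1 f2 ltac:(lra) H1) as [p1 Hp1].
exists p, p1; split; [split; [| split; [| split]] |].
- intros x Hx; rewrite (proj1 (Hp1 x Hx)); apply Hp, Hx.
- intros x Hx; rewrite (proj1 (Hp x Hx)).
  replace (k ^ 3 * (Rabs x - L) * f x) with (f2 x); [apply Hp1, Hx |].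
  specialize (Heq x Hx); rewrite (proj2 V_def x Hx) in Heq.
  replace (V0 * (Rabs x / L - 1)) with (V0 / L * (Rabs x - L)) in Heq by (field; lra).
  rewrite <- k_cubed in Heq.
  assert (Hh : 0 < hbar ^ 2 / (2 * m)).
  { apply Rdiv_lt_0_compat; [apply pow_lt |]; lra. }
  apply (Rmult_eq_reg_l (hbar ^ 2 / (2 * m))); [| lra].
  rewrite <- !Rmult_assoc in *; lra.
- rewrite (proj1 (Hp L ltac:(lra))), (proj1 (Hp (- L) ltac:(lra))); exact E.
- rewrite (proj1 (Hp1 L ltac:(lra))), (proj1 (Hp1 (- L) ltac:(lra))); exact E1.
- intros x Hx; symmetry; apply Hp, Hx.
Qed.

(** The equation and the boundary conditions have real coefficients, so real and imaginary parts
    solve the real problem separately. *)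
Lemma eigenspace_components (s : R) (psi : R -> C) :
  eigenspace hbar m L V s 0 psi ->
  exists p p1 q q1, well_solution k L s p p1 /\ well_solution k L s q q1 /\
    forall x, - L <= x <= L -> psi x = (p x, q x).
Proof.
intros (dpsi & d2psi & H & H1 & Heq & E & E1).
destruct (well_solution_extension s (fun x => fst (psi x)) (fun x => fst (dpsi x))
  (fun x => fst (d2psi x))) as [p [p1 [Hp Ep]]].
- intros x Hx; apply (is_derive_on_components (- L) L psi x (dpsi x) Hx), H, Hx.
- intros x Hx; apply (is_derive_on_components (- L) L dpsi x (d2psi x) Hx), H1, Hx.
- intros x Hx; specialize (Heq x Hx); apply (f_equal fst) in Heq; simpl in Heq |- *; lra.
- apply (f_equal fst) in E; simpl in E; lra.
- apply (f_equal fst) in E1; simpl in E1; lra.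
- destruct (well_solution_extension s (fun x => snd (psi x)) (fun x => snd (dpsi x))
    (fun x => snd (d2psi x))) as [q [q1 [Hq Eq]]].
  + intros x Hx; apply (is_derive_on_components (- L) L psi x (dpsi x) Hx), H, Hx.
  + intros x Hx; apply (is_derive_on_components (- L) L dpsi x (d2psi x) Hx), H1, Hx.
  + intros x Hx; specialize (Heq x Hx); apply (f_equal snd) in Heq; simpl in Heq |- *; lra.
  + apply (f_equal snd) in E; simpl in E; lra.
  + apply (f_equal snd) in E1; simpl in E1; lra.
  + exists p, p1, q, q1; split; [exact Hp | split; [exact Hq |]].
    intros x Hx; rewrite <- Ep, <- Eq by exact Hx; apply surjective_pairing.
Qed.

Variables u u1 v v1 : R -> R.
Hypothesis du : forall x, is_derive u x (u1 x).
Hypothesis du1 : forall x, is_derive u1 x (x * u x).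
Hypothesis dv : forall x, is_derive v x (v1 x).
Hypothesis dv1 : forall x, is_derive v1 x (x * v x).
Hypothesis u_0 : u 0 = 1.
Hypothesis u1_0 : u1 0 = 0.
Hypothesis v_0 : v 0 = 0.
Hypothesis v1_0 : v1 0 = 1.

Let M := matching u u1 v v1 k L.
Let phi := mode u v k L.

(** Only parities [sg] with [M bs sg = 0] contribute, each with at most one mode; this bounds the
    multiplicity of the eigenvalue [0]. *)
Lemma eigenfunction_decomposition (bs : bool) (psi : R -> C) :
  eigenspace hbar m L V (sgn bs) 0 psi ->
  exists a : bool -> C, (forall sg, M bs sg <> 0 -> a sg = RtoC 0) /\
    forall x, - L <= x <= L ->
      psi x = (a true * RtoC (phi bs true x) + a false * RtoC (phi bs false x))%C.
Proof.
intros Hpsi.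
destruct (eigenspace_components _ _ Hpsi) as (p & p1 & q & q1 & Hp & Hq & E).
assert (dec := well_solution_decomposition u u1 v v1 du du1 dv dv1 u_0 u1_0 v_0 v1_0
  k L k_pos L_pos bs).
destruct (dec p p1 Hp) as [a [Ha Ea]].
destruct (dec q q1 Hq) as [b [Hb Eb]].
exists (fun sg => (a sg, b sg)); split.
- intros sg Hsg.
  destruct (Rmult_integral _ _ (Ha sg)) as [-> | ]; [| contradiction].
  destruct (Rmult_integral _ _ (Hb sg)) as [-> | ]; [reflexivity | contradiction].
- intros x Hx; rewrite E, Ea, Eb by exact Hx.
  apply injective_projections; simpl; fold phi; ring.
Qed.

Lemma has_dim_0_eigenspace (bs : bool) :
  (forall sg, M bs sg <> 0) ->
  has_dim (fun x => - L <= x <= L) (eigenspace hbar m L V (sgn bs) 0) 0.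
Proof.
intros HM; exists (fun _ _ => RtoC 0); split; [| split].
- intros i Hi; lia.
- intros a _ i Hi; lia.
- intros psi Hpsi; exists (fun _ => RtoC 0); intros x Hx.
  destruct (eigenfunction_decomposition bs psi Hpsi) as [a [Ha Ea]].
  rewrite Ea, !Ha by auto.
  unfold lin_comb; rewrite sum_n_m_zero by lia.
  change (@zero C_AbelianMonoid) with (RtoC 0); ring.
Qed.

Lemma has_dim_1_eigenspace (bs sg : bool) :
  M bs sg = 0 -> M bs (negb sg) <> 0 ->
  has_dim (fun x => - L <= x <= L) (eigenspace hbar m L V (sgn bs) 0) 1.
Proof.
intros H0 H1; exists (fun _ x => RtoC (phi bs sg x)).
assert (lin : forall a x, lin_comb 1 a (fun _ x => RtoC (phi bs sg x)) x =
  (a 1%nat * RtoC (phi bs sg x))%C).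
{ intros a x; unfold lin_comb; now rewrite sum_n_n. }
split; [| split].
- intros _ _; apply eigenspace_of_well_solution with (p1 := mode' u1 v1 k L bs sg).
  apply mode_well_solution; assumption.
- intros a Ha i Hi; replace i with 1%nat by lia.
  destruct (mode_nontrivial u u1 v v1 du du1 dv dv1 u_0 u1_0 v1_0 k L k_pos L_pos bs sg)
    as [x [Hx Hnz]].
  specialize (Ha x Hx); rewrite lin in Ha.
  destruct (Ceq_dec (a 1%nat) 0) as [E | E]; [exact E | exfalso].
  apply (Cmult_neq_0 _ (RtoC (phi bs sg x)) E); [| exact Ha].
  intros E'; apply Hnz, RtoC_inj, E'.
- intros psi Hpsi.
  destruct (eigenfunction_decomposition bs psi Hpsi) as [a [Ha Ea]].
  exists (fun _ => a sg); intros x Hx; rewrite lin, Ea by exact Hx.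
  apply Ha in H1; destruct sg; simpl in H1; rewrite H1; ring.
Qed.

(** At [- (k * L)] the matchings are [u1] and [v] in the periodic case, [v1] and [u] in the
    antiperiodic one. The no-common-zero lemmas separate the two members of a pair. A zero in each
    pair would kill both products in [u v1 - u1 v = 1]. *)
Lemma matching_zero_unique (bs sg : bool) :
  M bs sg = 0 -> M bs (negb sg) <> 0 /\ forall sg', M (negb bs) sg' <> 0.
Proof.
assert (w := airy_wronskian u u1 v v1 du du1 dv dv1 u_0 u1_0 v1_0 (- (k * L))).
assert (neg : - (k * L) < 0) by (assert (0 < k * L) by (apply Rmult_lt_0_compat; lra); lra).
assert (N1 := no_common_zero_u1_v u u1 v v1 du du1 dv dv1 u_0 u1_0 v_0 v1_0 _ neg).
assert (N2 := no_common_zero_u_v1 u u1 v v1 du du1 dv dv1 u_0 u1_0 v_0 v1_0 _ neg).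
unfold M, matching.
destruct bs, sg; simpl; intros E; rewrite E in w;
  (split; [| intros []; simpl; intros E'; rewrite E' in w; lra]);
  intros E'; first [exact (N1 E E') | exact (N1 E' E) | exact (N2 E E') | exact (N2 E' E)].
Qed.

End Spectrum.

(** * From multiplicities to band edges *)

Lemma occurs_0 (e : nat -> R) (E : R) : occurs e E 0 -> forall p, e p <> E.
Proof.
intros [l [_ [Hl H]]] p Hp; apply length_zero_iff_nil in Hl; subst l.
exact (proj2 (H p) Hp).
Qed.

Lemma occurs_1 (e : nat -> R) (E : R) :
  occurs e E 1 -> exists p, e p = E /\ forall q, e q = E -> q = p.
Proof.
intros [l [_ [Hl H]]].
destruct l as [| p [| ]]; try discriminate.
exists p; split; [apply H; now left |].
intros q Hq; apply H in Hq; destruct Hq as [-> | []]; reflexivity.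
Qed.

Theorem proposition1
  (hbar m L0 V0 : R)
  (hbar_pos : 0 < hbar) (m_pos : 0 < m) (L0_pos : 0 < L0) (V0_pos : 0 < V0)
  (V : R -> R) (V_def : triangular_potential L0 V0 V)
  (Emin Emax : nat -> R) (E_def : band_edges hbar m L0 V Emin Emax)
  (u v : R -> R)
  (u_airy : airy_solution u) (u_0 : u 0 = 1) (du_0 : Derive u 0 = 0)
  (v_airy : airy_solution v) (v_0 : v 0 = 0) (dv_0 : Derive v 0 = 1)
  (c ct : nat -> R)
  (c_even : lists_decreasing (fun x => Derive v x = 0)
              (fun j => - c (2 * j)%nat))
  (c_odd : lists_decreasing (fun x => x <> 0 /\ v x = 0)
              (fun j => - c (2 * j + 1)%nat))
  (ct_even : lists_decreasing (fun x => u x = 0)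
              (fun j => - ct (2 * j)%nat))
  (ct_odd : lists_decreasing (fun x => x <> 0 /\ Derive u x = 0)
              (fun j => - ct (2 * j + 1)%nat)) :
  let cc := Rpower (2 * m * V0 * L0 ^ 2 / hbar ^ 2) (1 / 3) in
  (exists! p : nat, Emin p = 0 \/ Emax p = 0) <->
  (exists p : nat, cc = c p \/ cc = ct p).
Proof.
intros cc.
assert (cc_pos : 0 < cc) by apply exp_pos.
assert (cc_cubed : cc ^ 3 = 2 * m * V0 * L0 ^ 2 / hbar ^ 2).
{ assert (0 < hbar ^ 2) by (apply pow_lt; lra).
  assert (0 < L0 ^ 2) by (apply pow_lt; lra).
  rewrite <- Rpower_pow by exact cc_pos; unfold cc; rewrite Rpower_mult.
  replace (1 / 3 * INR 3) with 1 by (simpl; field).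
  apply Rpower_1, Rdiv_lt_0_compat; [| lra].
  repeat apply Rmult_lt_0_compat; lra. }
set (k := cc / L0).
assert (k_pos : 0 < k) by (apply Rdiv_lt_0_compat; lra).
assert (k_L0 : k * L0 = cc) by (unfold k; field; lra).
assert (k_cubed : hbar ^ 2 / (2 * m) * k ^ 3 = V0 / L0).
{ unfold k; replace ((cc / L0) ^ 3) with (cc ^ 3 / L0 ^ 3) by (field; lra).
  rewrite cc_cubed; field; lra. }
assert (du : forall x, is_derive u x (Derive u x)) by (intros x; apply Derive_correct, u_airy).
assert (dv : forall x, is_derive v x (Derive v x)) by (intros x; apply Derive_correct, v_airy).
assert (du1 := proj2 u_airy); assert (dv1 := proj2 v_airy).
set (M := matching u (Derive u) v (Derive v) k L0).
(* [edge true] lists the periodic eigenvalues and [edge false] the antiperiodic ones; each band has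
   one edge in each list, at the same index [p]. *)
set (edge := fun (bs : bool) p =>
  if bs then if Nat.even p then Emin p else Emax p
  else if Nat.even p then Emax p else Emin p).
assert (edge_iff : forall p, (Emin p = 0 \/ Emax p = 0) <-> exists bs, edge bs p = 0).
{ intros p; unfold edge; destruct (Nat.even p); split.
  - intros [H | H]; [exists true | exists false]; exact H.
  - intros [[] H]; auto.
  - intros [H | H]; [exists false | exists true]; exact H.
  - intros [[] H]; auto. }
assert (edge_dim : forall bs n,
  has_dim (fun x => - L0 <= x <= L0) (eigenspace hbar m L0 V (sgn bs) 0) n ->
  occurs (edge bs) 0 n).
{ intros [] n; apply E_def. }
assert (edge_none : forall bs, (forall sg, M bs sg <> 0) -> forall p, edge bs p <> 0).
{ intros bs H; apply occurs_0, edge_dim.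
  apply has_dim_0_eigenspace with V0 k u (Derive u) v (Derive v); assumption. }
(* As [k * L0 = cc], the four matchings are [u1], [v], [v1], [u] at [- cc], one for each list of
   zeros; [- cc] is nonzero, as the odd-indexed lists require. *)
assert (M_zero : (exists bs sg, M bs sg = 0) <-> exists p, cc = c p \/ cc = ct p).
{ unfold M, matching; rewrite k_L0; split.
  - intros [[] [[] H]]; simpl in H.
    + destruct (proj1 (proj2 ct_odd (- cc))) as [j Hj]; [split; [lra | exact H] |].
      exists (2 * j + 1)%nat; right; lra.
    + destruct (proj1 (proj2 c_odd (- cc))) as [j Hj]; [split; [lra | exact H] |].
      exists (2 * j + 1)%nat; left; lra.
    + destruct (proj1 (proj2 c_even (- cc)) H) as [j Hj].
      exists (2 * j)%nat; left; lra.
    + destruct (proj1 (proj2 ct_even (- cc)) H) as [j Hj].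
      exists (2 * j)%nat; right; lra.
  - intros [p Hp].
    destruct (Nat.Even_or_Odd p) as [[j ->] | [j ->]]; destruct Hp as [-> | ->].
    + exists false, true; apply (proj2 c_even); now exists j.
    + exists false, false; apply (proj2 ct_even); now exists j.
    + exists true, false; apply (proj2 c_odd); now exists j.
    + exists true, true; apply (proj2 ct_odd); now exists j. }
rewrite <- M_zero; split.
- intros [p [Hp _]].
  destruct (proj1 (edge_iff p) Hp) as [bs Hbs].
  destruct (classic (exists bs sg, M bs sg = 0)) as [H | H]; [exact H | exfalso].
  apply (edge_none bs) with p; [| exact Hbs].
  intros sg E; apply H; now exists bs, sg.
(* [0] is a simple eigenvalue for [bs], hence occurs at one index [p] only, and is not an eigenvalue
   for the other boundary condition, so no other band has it as an edge. *)
- intros [bs [sg H0]].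
  destruct (matching_zero_unique L0 k L0_pos k_pos u (Derive u) v (Derive v)
    du du1 dv dv1 u_0 du_0 v_0 dv_0 bs sg H0) as [H1 H2].
  destruct (occurs_1 (edge bs) 0) as [p [Hp Hu]].
  { apply edge_dim.
    apply has_dim_1_eigenspace with V0 k u (Derive u) v (Derive v) sg; assumption. }
  exists p; split; [apply edge_iff; now exists bs |].
  intros q Hq; symmetry.
  destruct (proj1 (edge_iff q) Hq) as [bs' Hbs'].
  destruct (Bool.bool_dec bs' bs) as [-> | Hne]; [exact (Hu q Hbs') | exfalso].
  apply (edge_none bs') with q; [| exact Hbs'].
  replace bs' with (negb bs) by (destruct bs, bs'; try reflexivity; now contradict Hne).
  exact H2.
Qed.
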